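(* Let $\mathbb{F}_q$ be a finite field, $a,b\in\mathbb{F}_q$ with $b\neq0$, and $Q=\begin{pmatrix} a & b\\ 1 & 0\end{pmatrix}$, and suppose the characteristic polynomial $x^2-ax-b$ splits into distinct roots over $\mathbb{F}_q$. Suppose the multiplicative order of $-b$ in $\mathbb{F}_q^\times$ is $p^\alpha$ for some prime $p$ and positive integer $\alpha$. Then the lengths of the non-trivial orbits of $G=\langle Q\rangle$ acting on $\mathbb{F}_q\times\mathbb{F}_q$ are of one of two types: (a) all non-trivial orbits have the same length $l$, where $v_p(l)\ge\alpha$; or (b) there are orbits of length $l$ and orbits of length $p^{\alpha-k}l$ (and no others), where $k=v_p(l)<\alpha$.
   Context: $G=\langle Q\rangle$ acts on $\mathbb{F}_q\times\mathbb{F}_q$ (column vectors) by $v\mapsto Q^nv$; orbit length is the number of elements of the orbit; non-trivial orbits are orbits of non-zero vectors. $v_p$ is the $p$-adic valuation. *)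

(* Defs.v *)
From HB Require Import structures.
From mathcomp Require Import all_boot all_order all_algebra all_fingroup.

Set Implicit Arguments.
Unset Strict Implicit.
Unset Printing Implicit Defensive.

Import GRing.Theory.
Local Open Scope ring_scope.

Definition Qmx (F : finFieldType) (a b : F) : 'M[F]_2 :=
  \matrix_(i < 2, j < 2)
    if i == 0 then (if j == 0 then a else b)
    else (if j == 0 then 1 else 0).

Lemma Qmx_char_poly (F : finFieldType) (a b : F) :
  char_poly (Qmx a b) = 'X^2 - a *: 'X - b%:P.
Proof.
rewrite /char_poly (expand_det_row _ 0) big_ord_recl big_ord1.
rewrite /cofactor !det_mx11 !mxE /= expr0 expr1 !mul1r !mulr1n !mulr0n.
rewrite polyC0 subr0 polyC1 !sub0r mulN1r opprK mulr1.
by rewrite mulrBl -expr2 mul_polyC.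
Qed.

Lemma Qmx_unit (F : finFieldType) (a b : F) (hb : b != 0) :
  Qmx a b \is a GRing.unit.
Proof.
rewrite -[_ \is a _]/(Qmx a b \in unitmx) unitmxE unitfE.
rewrite (expand_det_row _ 0) big_ord_recl big_ord1.
rewrite /cofactor !det_mx11 !mxE /= mulr0 mulr0 add0r expr1 mulr1 mulrN1.
by rewrite oppr_eq0.
Qed.

Definition Qgl (F : finFieldType) (a b : F) (hb : b != 0) : {'GL_2[F]} :=
  FinRing.unit 'M[F]_2 (Qmx_unit a hb).

Lemma oppr_unit (F : finFieldType) (b : F) (hb : b != 0) :
  - b \is a GRing.unit.
Proof. by rewrite unitfE oppr_eq0. Qed.

Definition oppr_in_units (F : finFieldType) (b : F) (hb : b != 0) : {unit F} :=
  FinRing.unit F (oppr_unit hb).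

Definition mul_col (F : finFieldType) (v : 'cV[F]_2) (g : {'GL_2[F]}) :
  'cV[F]_2 := GLval g *m v.

(* The library's actions are right actions. Left multiplication on columns is
   one on the domain <[g]> because this group is commutative. *)
Lemma mul_col_is_action (F : finFieldType) (g : {'GL_2[F]}) :
  is_action <[g]>%g (@mul_col F).
Proof.
split=> [h v w | v _ _ /cycleP[i ->] /cycleP[j ->]].
  by apply: (can_inj (mulKmx (GL_unitmx h))).
rewrite /mul_col mulmxA -(GL_MxE (g ^+ j)%g).
by rewrite (commuteX2 j i (commute_refl g)).
Qed.

Definition cyc_action (F : finFieldType) (g : {'GL_2[F]}) :
  action <[g]>%g 'cV[F]_2 := Action (mul_col_is_action g).

Definition orbit_length (F : finFieldType) (g : {'GL_2[F]}) (v : 'cV[F]_2) :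
  nat := #|orbit (cyc_action g) <[g]>%g v|.

(* Main.v *)
Require Import Defs.
From HB Require Import structures.
From mathcomp Require Import all_boot all_order all_algebra all_fingroup.
From mathcomp Require Import cyclic ring.

Import GRing.Theory.
Local Open Scope ring_scope.

(** Writing r, s for the two eigenvalues of Q, the linear forms v0 - s v1 and
    v0 - r v1 separate vectors and are multiplied by r and s under Q.  Hence
    the length of a non-trivial orbit is ord r, ord s or lcm (ord r) (ord s).
    As rs = -b has order p^alpha, r^(p^alpha) and s^(p^alpha) are inverse to
    each other, so ord r and ord s differ at most in their p-parts; if they
    do differ, then the larger p-part is p^alpha. *)

Lemma order_expg_eq (gT : finGroupType) (x y : gT) (n : nat) :
  commute x y -> ((x * y) ^+ n = 1)%g -> #[x ^+ n]%g = #[y ^+ n]%g.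
Proof.
move=> cxy xyn1; rewrite -[in RHS]orderV; congr #[_]%g; apply/eqP.
by rewrite eq_mulgV1 invgK -expgMn // xyn1.
Qed.

(** Let [c] and [e] be the prime-to-[p] parts of the orders of [x] and [y], with [p]-parts [p ^ k]
    and [p ^ j]. Comparing the orders of the [p ^ alpha]-th powers gives [c = e] and [j <= alpha];
    the order of [x * y] then excludes [j < alpha]. *)
Lemma order_ltn_logn_mul (gT : finGroupType) (x y : gT) (p alpha : nat) :
  prime p -> commute x y -> #[x * y]%g = (p ^ alpha)%N ->
  (logn p #[x]%g < alpha)%N ->
  #[y]%g = (p ^ (alpha - logn p #[x]%g) * #[x]%g)%N.
Proof.
move=> pr_p cxy oxy lt_k.
have p_gt0 := prime_gt0 pr_p.
have oX : #[x ^+ (p ^ alpha)]%g = #[y ^+ (p ^ alpha)]%g.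
  by apply: order_expg_eq; rewrite // -oxy expg_order.
have [c coc Dx] := pfactor_coprime pr_p (order_gt0 x).
have [e coe Dy] := pfactor_coprime pr_p (order_gt0 y).
set k := logn p #[x]%g in lt_k Dx *; set j := logn p #[y]%g in Dy.
have pk n : (0 < p ^ n)%N by rewrite expn_gt0 p_gt0.
have gcdE (f n : nat) : coprime p f ->
    (gcdn (f * p ^ n) (p ^ alpha) = p ^ minn n alpha)%N.
  move=> cof; rewrite gcdnC Gauss_gcdr ?coprimeXl // gcdnC.
  have [le_na|lt_an] := leqP n alpha.
    by apply/gcdn_idPl; rewrite dvdn_exp2l.
  by apply/gcdn_idPr; rewrite dvdn_exp2l // ltnW.
move: oX; rewrite !orderXgcd Dx Dy !gcdE // (minn_idPl (ltnW lt_k)) mulnK //.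
move=> Dc.
(* Truncated subtraction covers both cases: the exponent is 0 when [j <= alpha]. *)
have Dc' : c = (e * p ^ (j - alpha))%N.
  rewrite Dc; have [le_ja|lt_aj] := leqP j alpha.
    by rewrite (eqP le_ja) expn0 muln1 mulnK.
  by rewrite -[in LHS](subnK (ltnW lt_aj)) expnD mulnA mulnK.
(* Otherwise [p] would divide [c]. *)
have le_ja : (j <= alpha)%N.
  rewrite -subn_eq0 -leqn0 leqNgt; apply/negP => j_gt0.
  by move: coc; rewrite Dc' -(prednK j_gt0) expnS mulnCA coprimeMr /coprime
     gcdnn gtn_eqF // prime_gt1.
have Ec : c = e by rewrite Dc' (eqP le_ja) muln1.
have le_aj : (alpha <= j)%N.
  rewrite leqNgt; apply/negP => lt_ja.
  (* This exponent is a common multiple of both orders. As [c] is prime to [p], [p ^ alpha] would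
     divide [p ^ maxn k j], although [k] and [j] are both below [alpha]. *)
  have: (#[x * y]%g %| c * p ^ maxn k j)%N.
    rewrite order_dvdn expgMn //; apply/eqP.
    have -> : (x ^+ (c * p ^ maxn k j) = 1)%g.
      by apply/eqP; rewrite -order_dvdn Dx dvdn_mul // dvdn_exp2l // leq_maxl.
    have -> : (y ^+ (c * p ^ maxn k j) = 1)%g.
      by apply/eqP; rewrite -order_dvdn Dy Ec dvdn_mul // dvdn_exp2l ?leq_maxr.
    by rewrite mulg1.
  rewrite oxy Gauss_dvdr ?coprimeXl //.
  by rewrite dvdn_Pexp2l ?prime_gt1 // leqNgt gtn_max lt_k lt_ja.
have -> : j = alpha by apply/eqP; rewrite eqn_leq le_ja le_aj.
by rewrite -Ec mulnCA -expnD subnK // ltnW.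
Qed.

Lemma order_geq_logn_mul (gT : finGroupType) (x y : gT) (p alpha : nat) :
  prime p -> commute x y -> #[x * y]%g = (p ^ alpha)%N ->
  (alpha <= logn p #[x]%g)%N -> (alpha <= logn p #[y]%g)%N ->
  #[x]%g = #[y]%g.
Proof.
move=> pr_p cxy oxy lex ley.
have dx : (p ^ alpha %| #[x]%g)%N by rewrite pfactor_dvdn ?order_gt0.
have dy : (p ^ alpha %| #[y]%g)%N by rewrite pfactor_dvdn ?order_gt0.
have: #[x ^+ (p ^ alpha)]%g = #[y ^+ (p ^ alpha)]%g.
  by apply: order_expg_eq; rewrite // -oxy expg_order.
by rewrite !orderXdiv // => oX; rewrite -(divnK dx) oX divnK.
Qed.

(** The stabilizer of [v] is generated by [g ^+ d]. Taking [n] to be the order of [g] shows that [d]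
    divides that order, so the stabilizer has index [d]. *)
Lemma orbit_length_period (F : finFieldType) (g : {'GL_2[F]}) (v : 'cV[F]_2)
    (d : nat) :
  (forall n, (mul_col v (g ^+ n)%g == v) = (d %| n)%N) -> orbit_length g v = d.
Proof.
move=> fixP.
have dg : (d %| #[g]%g)%N.
  by rewrite -fixP expg_order /mul_col /= mul1mx.
rewrite /orbit_length card_orbit_in // -divgS ?subsetIl //.
rewrite /=; have -> : ('C_(<[g]>)[v | cyc_action g] = <[g ^+ d]>)%g.
  apply/setP=> h; apply/idP/idP.
    case/setIP=> /cycleP[i ->] /astab_act/(_ (set11 v))/eqP /=.
    by rewrite fixP => /dvdnP[j ->]; rewrite mulnC expgM mem_cycle.
  case/cycleP=> i ->; rewrite -expgM !inE mem_cycle sub1set inE /=.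
  by rewrite fixP dvdn_mulr.
rewrite -[#|<[g ^+ d]>|%g]/#[g ^+ d]%g orderXdiv // -[#|<[g]>|%g]/#[g]%g.
by rewrite divnA // mulKn // order_gt0.
Qed.

(** For a root [t], the row [(1, -t)] is a left eigenvector of Q for the other root. Its kernel is
    the eigenline of [t], spanned by [(t, 1)]. *)
Definition eigenform (F : finFieldType) (t : F) (v : 'cV[F]_2) : F :=
  v 0 0 - t * v 1 0.

Lemma eigenform_inj (F : finFieldType) (r s : F) (v w : 'cV[F]_2) :
  r != s -> eigenform F s v = eigenform F s w ->
  eigenform F r v = eigenform F r w -> v = w.
Proof.
rewrite /eigenform => rs Es Er.
have E1 : v 1 0 = w 1 0.
  apply: (mulfI (_ : r - s != 0)); first by rewrite subr_eq0.
  have -> : (r - s) * v 1 0 = (v 0 0 - s * v 1 0) - (v 0 0 - r * v 1 0) by ring.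
  by rewrite Es Er; ring.
have E0 : v 0 0 = w 0 0 by move: Es; rewrite E1 => /addIr.
apply/matrixP=> i j; rewrite ord1.
have /orP[/eqP-> | /eqP->] // : (i == 0) || (i == 1).
by case: i => [[|[|]]].
Qed.

Lemma eigenform_Qgl (F : finFieldType) (a b : F) (hb : b != 0) (r s : F)
    (v : 'cV[F]_2) (n : nat) :
  a = r + s -> b = - (r * s) ->
  eigenform F s (mul_col v (Qgl a hb ^+ n)%g) = r ^+ n * eigenform F s v.
Proof.
move=> Da Db; elim: n => [|n IHn].
  by rewrite expg0 /mul_col /= mul1mx mul1r.
have -> : mul_col v (Qgl a hb ^+ n.+1)%g
    = Qmx a b *m mul_col v (Qgl a hb ^+ n)%g.
  by rewrite expgS /mul_col mulmxA.
rewrite exprS -mulrA -IHn; move: (mul_col _ _) => w.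
rewrite /eigenform !mxE !big_ord_recl !big_ord0 !mxE /=.
rewrite (_ : lift ord0 ord0 = 1); last exact: val_inj.
by rewrite Da Db; ring.
Qed.

(** Evaluating both polynomials at 0 determines [b]; evaluating them at 1 then determines [a]. *)
Lemma split_Qmx_roots (F : finFieldType) (a b r s : F) :
  char_poly (Qmx a b) = ('X - r%:P) * ('X - s%:P) ->
  a = r + s /\ b = - (r * s).
Proof.
rewrite Qmx_char_poly => E.
have evalE x : x ^+ 2 - a * x - b = (x - r) * (x - s).
  by move/(congr1 (fun q : {poly F} => q.[x])): E; rewrite !hornerE.
have Db : b = - (r * s).
  transitivity (0 ^+ 2 - a * 0 - (0 ^+ 2 - a * 0 - b)); first by ring.
  by rewrite evalE; ring.
split=> //.
transitivity (1 - b - (1 ^+ 2 - a * 1 - b)); first by ring.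
by rewrite evalE Db; ring.
Qed.

Theorem mainTheorem7 (F : finFieldType) (a b : F) (hb : b != 0)
  (hsplit : exists r s : F,
     r != s /\ char_poly (Qmx a b) = ('X - r%:P) * ('X - s%:P))
  (p alpha : nat) (hp : prime p) (halpha : (0 < alpha)%N)
  (hord : #[oppr_in_units hb]%g = (p ^ alpha)%N) :
  (exists l : nat,
     (alpha <= logn p l)%N /\
     (forall v : 'cV[F]_2, v != 0 -> orbit_length (Qgl a hb) v = l))
  \/
  (exists l k : nat,
     [/\ k = logn p l,
         (k < alpha)%N,
         (exists v : 'cV[F]_2, v != 0 /\ orbit_length (Qgl a hb) v = l),
         (exists v : 'cV[F]_2,
            v != 0 /\ orbit_length (Qgl a hb) v = (p ^ (alpha - k) * l)%N) &
         (forall v : 'cV[F]_2, v != 0 ->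
            orbit_length (Qgl a hb) v = l \/
            orbit_length (Qgl a hb) v = (p ^ (alpha - k) * l)%N)]).
Proof.
case: hsplit => r [s [rs /split_Qmx_roots[Da Db]]].
have rs0 : r * s != 0 by rewrite -oppr_eq0 -Db.
have [r0 s0] : r != 0 /\ s != 0 by apply/andP; rewrite -negb_or -mulf_eq0.
have ur : r \is a GRing.unit by rewrite unitfE.
have us : s \is a GRing.unit by rewrite unitfE.
pose x := FinRing.unit F ur; pose y := FinRing.unit F us.
have cxy : commute x y by apply: val_inj; rewrite /= mulrC.
have oxy : #[x * y]%g = (p ^ alpha)%N.
  by rewrite -hord; congr #[_]%g; apply: val_inj; rewrite /= Db opprK.
have oyx : #[y * x]%g = (p ^ alpha)%N by rewrite -cxy.
pose fs := eigenform F s; pose fr := eigenform F r.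
(* In the coordinates [fs], [fr] the matrix is diagonal, so each nonzero coordinate imposes one
   divisibility condition on [n]. *)
have fixE n (v : 'cV[F]_2) : (mul_col v (Qgl a hb ^+ n)%g == v) =
    ((fs v == 0) || (#[x]%g %| n)%N) && ((fr v == 0) || (#[y]%g %| n)%N).
  have Es := eigenform_Qgl F a b hb r s v n Da Db.
  have Er : fr (mul_col v (Qgl a hb ^+ n)%g) = s ^+ n * fr v.
    by apply: eigenform_Qgl; rewrite ?Da ?Db 1?addrC // mulrC.
  have dvdE (t : F) (ut : t \is a GRing.unit) c :
      (c == 0) || (#[FinRing.unit F ut]%g %| n)%N = (t ^+ n * c == c).
    rewrite order_dvdn -val_eqE FinRing.val_unitX /=.
    rewrite -[X in _ = (_ == X)]mul1r -[RHS]subr_eq0 -mulrBl.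
    by rewrite mulf_eq0 subr_eq0 orbC.
  rewrite /x /y !dvdE -Er -Es; apply/eqP/andP=> [->|[/eqP E1 /eqP E2]] //.
  exact: eigenform_inj rs E1 E2.
have f0 (v : 'cV[F]_2) : v != 0 -> ~~ ((fs v == 0) && (fr v == 0)).
  apply: contra => /andP[/eqP E1 /eqP E2]; apply/eqP.
  by apply: (eigenform_inj F r s v 0 rs); rewrite -/fs -/fr ?E1 ?E2
    /fs /fr /eigenform !mxE mulr0 subr0.
(* On an eigenline only one condition remains; off both eigenlines the two combine into divisibility
   by the lcm. *)
have lenE (v : 'cV[F]_2) : v != 0 -> orbit_length (Qgl a hb) v =
    if fs v == 0 then #[y]%g else if fr v == 0 then #[x]%g
    else lcmn #[x]%g #[y]%g.
  move=> /f0 fv0; apply: orbit_length_period => n; rewrite fixE; move: fv0.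
  by case: (fs v == 0); case: (fr v == 0); rewrite //= ?andbT // dvdn_lcm.
have eigenvector t u : u != t -> exists v : 'cV[F]_2,
    [/\ v != 0, eigenform F t v == 0 & eigenform F u v != 0].
  move=> ut; pose v : 'cV[F]_2 := \col_i (if i == 0 then t else 1).
  exists v; have v1 : v 1 0 = 1 by rewrite mxE.
  have v0 : v 0 0 = t by rewrite mxE.
  rewrite /eigenform v0 v1 !mulr1 subrr eqxx subr_eq0 (eq_sym t) ut; split=> //.
  by apply/eqP=> /matrixP/(_ 1 0) /eqP; rewrite v1 mxE oner_eq0.
have [vy [vy0 vys vyr]] := eigenvector s r rs.
have [vx [vx0 vxr vxs]] : exists v : 'cV[F]_2,
    [/\ v != 0, fr v == 0 & fs v != 0] by apply: eigenvector; rewrite eq_sym.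
have Lx : orbit_length (Qgl a hb) vx = #[x]%g.
  by rewrite lenE // (negPf vxs) vxr.
have Ly : orbit_length (Qgl a hb) vy = #[y]%g by rewrite lenE // vys.
(* If either order has [p]-valuation below [alpha], it divides the other, so the lcm adds no third
   length and type (b) holds, with eigenvectors realizing both lengths. Otherwise the two orders
   coincide, which is type (a). *)
have [lex|ltx] := leqP alpha (logn p #[x]%g); last first.
  right; exists #[x]%g, (logn p #[x]%g).
  have Dy := order_ltn_logn_mul _ x y p alpha hp cxy oxy ltx.
  split=> //; [by exists vx | by exists vy; rewrite Ly | move=> v v0].
  rewrite lenE // -Dy; case: ifP => _; first by right.
  case: ifP => _; first by left.
  by right; apply/lcmn_idPr; rewrite Dy dvdn_mull.
have [ley|lty] := leqP alpha (logn p #[y]%g); last first.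
  right; exists #[y]%g, (logn p #[y]%g).
  have Dx := order_ltn_logn_mul _ y x p alpha hp (commute_sym cxy) oyx lty.
  split=> //; [by exists vy | by exists vx; rewrite Lx | move=> v v0].
  rewrite lenE // -Dx; case: ifP => _; first by left.
  case: ifP => _; first by right.
  by right; apply/lcmn_idPl; rewrite Dx dvdn_mull.
left; exists #[x]%g; split=> // v v0.
rewrite lenE // -(order_geq_logn_mul _ x y p alpha hp cxy oxy lex ley).
rewrite (lcmn_idPl (dvdnn _)).
by do 2?case: ifP.
Qed.
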